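(* Let $(S,\cdot,\ast)$ be a regular $\star$-semigroup. Define binary operations $+$ and $\oplus$ on $S$ by $a+b=aba^\ast$ and $a\oplus b=bab^\ast$ for all $a,b\in S$. Let $r_S$ be the map associated to $(S,+,\cdot,\ast)$ (respectively, to $(S,\oplus,\cdot,\ast)$). In each of the two cases: if $r_S$ is a solution of the Yang-Baxter equation, then $(S,\cdot,\ast)$ is completely regular, orthodox and locally inverse; and if $(S,\cdot)$ is commutative, then $r_S$ is a solution of the Yang-Baxter equation.
   Context: A regular $\star$-semigroup is a triple $(S,\cdot,\ast)$ where $(S,\cdot)$ is a semigroup on a non-empty set and $\ast:S\to S$, $x\mapsto x^\ast$, satisfies $xx^\ast x=x$, $(x^\ast)^\ast=x$, $(xy)^\ast=y^\ast x^\ast$ for all $x,y\in S$. It is called completely regular if $a\,\mathcal H\,a^2$ for all $a\in S$ ($\mathcal H=\mathcal L\cap\mathcal R$ being Green's relation), orthodox if the product of any two idempotents is idempotent, and locally inverse if $eSe$ is an inverse semigroup for every idempotent $e$. For a set $S$ with binary operations $+,\cdot$ ($+$ not necessarily associative) and a unary operation $\ast$, the map associated to $(S,+,\cdot,\ast)$ is $r_S:S\times S\to S\times S$, $r_S(a,b)=(a(a^{\ast}+b),\,(a^{\ast}+b)^{\ast}b)$; similarly with $\oplus$ in place of $+$. A map $r:S\times S\to S\times S$ is a (set-theoretic) solution of the Yang-Baxter equation if $(r\times \mathrm{id}_S)(\mathrm{id}_S\times r)(r\times \mathrm{id}_S)=(\mathrm{id}_S\times r)(r\times \mathrm{id}_S)(\mathrm{id}_S\times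 r)$ as maps $S^3\to S^3$. *)

(* Defs.v *)
From mathcomp Require Import ssreflect ssrfun ssrbool monoid.

Set Implicit Arguments.
Unset Strict Implicit.
Unset Printing Implicit Defensive.

Local Open Scope group_scope.

(* [semigroupType] carries a choice structure on its carrier; [magmaType] does
   not, so associativity is stated here for a bare magma. *)
Record regular_star_semigroup (S : magmaType) (star : S -> S) : Prop := {
  rss_nonempty : inhabited S;
  rss_mulA : associative (@mul S);
  rss_regular : forall x : S, x * star x * x = x;
  rss_starK : involutive star;
  rss_starM : forall x y : S, star (x * y) = star y * star x
}.

Section Semigroup.
Variable S : magmaType.
Implicit Types (a b e f s x y : S) (A : S -> Prop).

(* S^1 a and a S^1, where S^1 is S with an identity adjoined if necessary. *)
Definition left_principal_ideal a : S -> Prop :=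
  fun x => x = a \/ exists s, x = s * a.
Definition right_principal_ideal a : S -> Prop :=
  fun x => x = a \/ exists s, x = a * s.

Definition greenL a b : Prop :=
  forall x, left_principal_ideal a x <-> left_principal_ideal b x.
Definition greenR a b : Prop :=
  forall x, right_principal_ideal a x <-> right_principal_ideal b x.
Definition greenH a b : Prop := greenL a b /\ greenR a b.

Definition idempotent_elt e : Prop := e * e = e.

Definition completely_regular : Prop := forall a, greenH a (a * a).

Definition orthodox : Prop :=
  forall e f, idempotent_elt e -> idempotent_elt f -> idempotent_elt (e * f).

Definition local_subset e : S -> Prop := fun x => exists s, x = e * s * e.

Definition inverse_subsemigroup A : Prop :=
  [/\ exists x, A x,
      forall x y, A x -> A y -> A (x * y)
    & forall x, A x -> exists! y, [/\ A y, x * y * x = x & y * x * y = y]].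

Definition locally_inverse : Prop :=
  forall e, idempotent_elt e -> inverse_subsemigroup (local_subset e).

Variable star : S -> S.

Definition star_add a b : S := a * b * star a.
Definition star_oplus a b : S := b * a * star b.

Definition associated_map (add : S -> S -> S) (p : S * S) : S * S :=
  let: (a, b) := p in
  (a * add (star a) b, star (add (star a) b) * b).

End Semigroup.

Section YangBaxter.
Variables (T : Type) (r : T * T -> T * T).

Definition r_times_id (t : T * T * T) : T * T * T :=
  let: (x, y, z) := t in let: (x', y') := r (x, y) in (x', y', z).
Definition id_times_r (t : T * T * T) : T * T * T :=
  let: (x, y, z) := t in let: (y', z') := r (y, z) in (x, y', z').

Definition yang_baxter_solution : Prop :=
  r_times_id \o id_times_r \o r_times_id
  =1 id_times_r \o r_times_id \o id_times_r.

End YangBaxter.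

(* Main.v *)
(** On projections [x], [y], [z] the first two components of the Yang-Baxter
    equation read [xyx z xyx = xyzyx] and [xyx z xy = xyzy xyz xyzy].
    Together they make [xyz] idempotent; since an idempotent [e] is the product
    of the projections [e (star e)] and [(star e) e], orthodoxy follows.  For
    projections [p], [q] below [x], the second one at [(p, x, q)] says
    [pqp = pq], so [p] and [q] commute, which gives local inverseness.  The
    first component at [(a, q, q)], where [q = a (star a)], is
    [a = q (star a) a a], which puts [a] in [S a^2].  The map for [oplus] is the
    conjugate of the map for [+] under [(a, b) |-> (star b, star a)], an
    operation that swaps the two sides of the Yang-Baxter equation. *)
Require Import Defs.
From mathcomp Require Import ssreflect ssrfun ssrbool monoid.

Set Implicit Arguments.
Unset Strict Implicit.
Unset Printing Implicit Defensive.

Local Open Scope group_scope.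

(** The functions [l] and [m] need only agree pointwise with the components of [r], so simplified
    formulas can be fed in directly. *)
Lemma yang_baxter_components (T : Type) (r : T * T -> T * T)
    (l m : T -> T -> T) :
  (forall a b, r (a, b) = (l a b, m a b)) ->
  yang_baxter_solution r <-> forall x y z,
    [/\ l (l x y) (l (m x y) z) = l x (l y z),
        m (l x y) (l (m x y) z) = l (m x (l y z)) (m y z)
      & m (m x y) z = m (m x (l y z)) (m y z)].
Proof.
move=> rE; split=> [ybe x y z | eqs [[x y] z]].
  have := ybe (x, y, z); rewrite /comp /id_times_r /r_times_id /= !rE.
  by move=> -[-> -> ->].
rewrite /comp /id_times_r /r_times_id /= !rE.
by have [-> -> ->] := eqs x y z.
Qed.

(** * Absorption laws and projections *)

Section RegularStarSemigroup.
Variables (S : magmaType) (star : S -> S).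
Hypothesis hS : regular_star_semigroup star.
Implicit Types (a b e f p q x y z : S).

Let mulA : associative (@mul S) := rss_mulA hS.
Let starK : involutive star := rss_starK hS.
Let starM x y : star (x * y) = star y * star x := rss_starM hS x y.

Lemma mul_star_mul x : x * (star x * x) = x.
Proof. by rewrite mulA (rss_regular hS). Qed.

Lemma mul_star_mulK x y : x * (star x * (x * y)) = x * y.
Proof. by rewrite !mulA (rss_regular hS). Qed.

Lemma star_mul_star x : star x * (x * star x) = star x.
Proof. by rewrite -{2}[x]starK mul_star_mul. Qed.

Lemma star_mul_starK x y : star x * (x * (star x * y)) = star x * y.
Proof. by rewrite -{2}[x]starK mul_star_mulK. Qed.

Definition projection p := star p = p /\ p * p = p.

Lemma projection_mul_star x : projection (x * star x).
Proof. by split; rewrite ?starM ?starK // -mulA star_mul_star. Qed.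

Lemma projection_star_mul x : projection (star x * x).
Proof. by rewrite -{2}[x]starK; exact: projection_mul_star. Qed.

Lemma projectionK p x : projection p -> p * (p * x) = p * x.
Proof. by case=> _ pp; rewrite mulA pp. Qed.

(** This is regularity of [p * q], whose star is [q * p]. *)
Lemma projection_mulI p q : projection p -> projection q ->
  p * (q * (p * q)) = p * q.
Proof.
move=> [sp pp] [sq qq]; have := mul_star_mul (p * q).
by rewrite starM sp sq -!mulA (mulA q q) qq (mulA p p) pp.
Qed.

Lemma projection_mulIK p q x : projection p -> projection q ->
  p * (q * (p * (q * x))) = p * (q * x).
Proof. by move=> hp hq; have := projection_mulI hp hq; rewrite !mulA => ->. Qed.

Lemma idempotent_star e : idempotent_elt e -> idempotent_elt (star e).
Proof. by rewrite /idempotent_elt -starM => ->. Qed.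

Lemma idempotent_projections e : idempotent_elt e ->
  e = (e * star e) * (star e * e).
Proof.
move=> ee; rewrite -mulA (mulA (star e)) (idempotent_star ee).
by rewrite mul_star_mul.
Qed.

(** * Three conditions that force the three structural properties *)

Section Consequences.
Hypothesis mul3_idem : forall x y z, projection x -> projection y ->
  projection z -> idempotent_elt (x * y * z).
Hypothesis local_comm : forall x p q, projection x -> projection p ->
  projection q -> x * p = p -> x * q = q -> p * q = q * p.
Hypothesis mem_sq : forall a, a = a * (star a * (star a * (a * a))).

Lemma projections_completely_regular : completely_regular S.
Proof.
(* The star of [mem_sq] at [star a]: it puts [a] in the right ideal of [a * a], as [mem_sq] does on
   the left. *)
have mem_sq' a : a = (a * a) * (star a * (star a * a)).
  by rewrite -{1}[a]starK {1}[star a]mem_sq !starM !starK -!mulA.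
move=> a; split=> x; split.
- case=> [-> | [s ->]]; right.
    by exists (a * (star a * star a)); rewrite {1}[a]mem_sq -!mulA.
  by exists (s * (a * (star a * star a))); rewrite {1}[a]mem_sq -!mulA.
- by case=> [-> | [s ->]]; right; [exists a | exists (s * a); rewrite -mulA].
- case=> [-> | [s ->]]; right.
    by exists (star a * (star a * a)); rewrite {1}[a]mem_sq'.
  by exists (star a * (star a * a) * s); rewrite {1}[a]mem_sq' -!mulA.
- by case=> [-> | [s ->]]; right; [exists a | exists (a * s); rewrite -mulA].
Qed.

Lemma projections_orthodox : orthodox S.
Proof.
(* As [g] is a product of two projections, [g * r] is a product of three. The two projections
   composing [f] are then absorbed one at a time. *)
have idem_mul_proj g r : idempotent_elt g -> projection r ->
    idempotent_elt (g * r).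
  move=> gg hr; rewrite [g](idempotent_projections gg).
  by apply: mul3_idem => //;
    [exact: projection_mul_star | exact: projection_star_mul].
move=> e f ee ff; rewrite [f](idempotent_projections ff) mulA.
apply: (idem_mul_proj _ _ _ (projection_star_mul f)).
exact: (idem_mul_proj _ _ ee (projection_mul_star f)).
Qed.

(** Both [f * star f] and [star f * f] lie below [x], hence commute; their product in one order is
    [f], in the other [star f]. *)
Lemma local_idempotents_projection x f : projection x -> idempotent_elt f ->
  x * f = f -> f * x = f -> projection f.
Proof.
move=> hx ff xf fx; have [sx xx] := hx.
have xf' : x * star f = star f by rewrite -{1}sx -starM fx.
have hl := projection_mul_star f; have hr := projection_star_mul f.
have lr : (f * star f) * (star f * f) = (star f * f) * (f * star f).
  by apply: (local_comm hx hl hr); rewrite mulA ?xf ?xf'.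
split=> //; rewrite [f in LHS](idempotent_projections ff) starM.
by rewrite (proj1 hl) (proj1 hr) -lr -idempotent_projections.
Qed.

(* For [a = e * star e], right translation by [a] embeds [eSe] into [aSa], whose
   idempotents are commuting projections. *)
Lemma local_idempotents_comm e f g : idempotent_elt e -> idempotent_elt f ->
  idempotent_elt g -> e * f = f -> f * e = f -> e * g = g -> g * e = g ->
  f * g = g * f.
Proof.
move=> ee ff gg ef fe eg ge; pose a := e * star e.
have ha : projection a := projection_mul_star e.
have ae : a * e = e by rewrite /a -mulA mul_star_mul.
have at_left t : e * t = t -> a * t = t by move=> <-; rewrite mulA ae.
have embed s t : e * t = t -> s * a * (t * a) = s * t * a.
  by move=> et; rewrite mulA -(mulA s a t) at_left.
have loc t : idempotent_elt t -> e * t = t -> t * e = t ->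
    projection (t * a) /\ a * (t * a) = t * a.
  move=> tt et te; have ata : a * (t * a) = t * a by rewrite mulA at_left.
  split=> //; apply: (local_idempotents_projection ha) => //.
    by rewrite /idempotent_elt embed ?tt.
  by rewrite -mulA (proj2 ha).
have [hf af] := loc f ff ef fe; have [hg ag] := loc g gg eg ge.
(* Since [a * e = e], right multiplication by [e] undoes the translation by [a]. *)
have := local_comm ha hf hg af ag; rewrite !embed // => /(congr1 (mul^~ e)).
by rewrite /= -!(mulA _ a e) ae -(mulA f) ge -mulA fe.
Qed.

Lemma projections_locally_inverse : locally_inverse S.
Proof.
move=> e ee; split.
- by exists (e * e * e), e.
- move=> _ _ [s ->] [t ->]; exists (s * e * e * t).
  by rewrite !mulA.
have memP x : local_subset e x -> e * x = x /\ x * e = x.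
  by case=> s ->; split; rewrite ?mulA ?ee // -mulA ee.
move=> x Ax; have [ex xe] := memP x Ax.
(* Compressing [star x] to the local monoid keeps it an inverse of [x], because [e] acts as identity
   on [x]. *)
exists (e * star x * e); split.
  split; first by exists (star x).
    by rewrite !mulA xe -(mulA _ e x) ex (rss_regular hS).
  by rewrite -!mulA (mulA e x) ex (mulA x e) xe star_mul_starK.
move=> y [[s ys] xyx yxy]; set z := _ * e.
have Az : local_subset e z by exists (star x).
have [ez ze] := memP z Az.
have xzx : x * z * x = x.
  by rewrite /z !mulA xe -(mulA _ e x) ex (rss_regular hS).
have zxz : z * x * z = z.
  by rewrite /z -!mulA (mulA e x) ex (mulA x e) xe star_mul_starK.
have [ey ye] : e * y = y /\ y * e = y by apply: memP; exists s.
clearbody z.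
have idl t : x * t * x = x -> idempotent_elt (x * t).
  by move=> h; rewrite /idempotent_elt mulA h.
have idr t : x * t * x = x -> idempotent_elt (t * x).
  by move=> h; rewrite /idempotent_elt -mulA (mulA x) h.
(* Classical uniqueness: commuting idempotents give [x * z = x * y] and [z * x = y * x], whence
   [z = z * x * z = y * x * y = y]. *)
have cl : x * y * (x * z) = x * z * (x * y).
  by apply: (local_idempotents_comm ee (idl _ xyx) (idl _ xzx));
    rewrite ?mulA ?ex // -mulA ?ye ?ze.
have cr : y * x * (z * x) = z * x * (y * x).
  by apply: (local_idempotents_comm ee (idr _ xyx) (idr _ xzx));
    rewrite ?mulA ?ey ?ez // -mulA xe.
have xzxy : x * z = x * y by move: cl; rewrite !mulA xyx xzx.
have zxyx : z * x = y * x.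
  by move: cr; rewrite -!mulA (mulA x z) xzx (mulA x y) xyx.
by rewrite -zxz zxyx -mulA xzxy mulA.
Qed.

End Consequences.

(** The components of the map for [+]. In a group with [star] the inverse, [lam a b] is [b * a] and
    [rho a b] is the commutator of [a] and [b]. *)
Definition lam a b := a * (star a * (b * a)).
Definition rho a b := star a * (star b * (a * b)).

Lemma star_add_mapE a b :
  associated_map star (star_add star) (a, b) = (lam a b, rho a b).
Proof. by rewrite /lam /rho /associated_map /star_add !starM !starK -!mulA. Qed.

(** * What the Yang-Baxter equation for [+] implies *)

Section YangBaxterSolution.
Hypothesis ybe : yang_baxter_solution (associated_map star (star_add star)).

Let ybe_eqs := proj1 (yang_baxter_components star_add_mapE) ybe.

Lemma lam_projection p b : projection p -> lam p b = p * (b * p).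
Proof. by case=> sp pp; rewrite /lam sp mulA pp. Qed.

Lemma rho_projections p q : projection p -> projection q ->
  rho p q = p * q.
Proof.
by move=> hp hq; rewrite /rho (proj1 hp) (proj1 hq) projection_mulI.
Qed.

Lemma projection_conj p q : projection p -> projection q ->
  projection (p * (q * p)).
Proof.
move=> hp hq; have [sp pp] := hp; have [sq qq] := hq.
split; first by rewrite !starM sp sq -mulA.
by rewrite -!mulA (projectionK _ hp) projection_mulIK.
Qed.

Lemma ybe_fst_projections x y z : projection x -> projection y ->
  projection z ->
  x * (y * (x * (z * (x * (y * x))))) = x * (y * (z * (y * x))).
Proof.
move=> hx hy hz; have [] := ybe_eqs x y z => + _ _.
rewrite rho_projections // ![lam x _]lam_projection //.
rewrite [lam y _]lam_projection // lam_projection; last exact: projection_conj.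
rewrite /lam !starM (proj1 hx) (proj1 hy) -!mulA.
by rewrite !(projectionK _ hx, projectionK _ hy, projection_mulIK _ hx hy,
  projection_mulIK _ hy hx, projection_mulI hx hy, projection_mulI hy hx).
Qed.

Lemma ybe_snd_projections x y z : projection x -> projection y ->
  projection z ->
  x * (y * (x * (z * (x * y))))
  = x * (y * (z * (y * (x * (y * (z * (x * (y * (z * y))))))))).
Proof.
move=> hx hy hz; have [_ + _] := ybe_eqs x y z.
have hxy := projection_conj hx hy.
rewrite [rho x y]rho_projections // [rho y z]rho_projections //.
rewrite [lam x _]lam_projection // [lam y _]lam_projection //.
rewrite [rho x _]rho_projections //; last exact: projection_conj.
rewrite /rho /lam !(starM, starK, proj1 hx, proj1 hy, proj1 hz) -!mulA.
rewrite !(projectionK _ hx, projectionK _ hy, projectionK _ hz,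
  projection_mulIK _ hx hy, projection_mulIK _ hy hx,
  projection_mulIK _ hy hz).
(* The left side is still [xyx z xyx z xy]; the projections [xyx] and [z] alternate, so it shrinks
   to [xyx z xy]. *)
by have := projection_mulIK (x * y) hxy hz; rewrite -!mulA => ->.
Qed.

(** Put [w = xyz]; regularity of [w] is [ccc]. The first identity times [yz] and the second times
    [xyz] have the same left side, while by [ccc] their right sides are [w] and [w * w]. *)
Lemma ybe_mul3_idem x y z : projection x -> projection y -> projection z ->
  idempotent_elt (x * y * z).
Proof.
move=> hx hy hz.
have ccc : x * (y * (z * (y * (x * (y * z))))) = x * (y * z).
  have := mul_star_mul (x * (y * z)).
  by rewrite !starM (proj1 hx) (proj1 hy) (proj1 hz) -!mulA
    !(projectionK _ hx, projectionK _ hz).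
have := congr1 (mul^~ (x * (y * z))) (ybe_snd_projections hx hy hz).
have := congr1 (mul^~ (y * z)) (ybe_fst_projections hx hy hz).
have := congr1 (mul^~ (x * (y * z))) ccc.
by rewrite /idempotent_elt /= -!mulA => cc ->; rewrite !ccc cc => <-.
Qed.

Lemma ybe_local_comm x p q : projection x -> projection p -> projection q ->
  x * p = p -> x * q = q -> p * q = q * p.
Proof.
move=> hx hp hq xp xq.
have px : p * x = p by rewrite -(proj1 hp) -{1}(proj1 hx) -starM xp.
have qx : q * x = q by rewrite -(proj1 hq) -{1}(proj1 hx) -starM xq.
have pqp : p * (q * p) = p * q.
  have pxK t : p * (x * t) = p * t by rewrite mulA px.
  have qxK t : q * (x * t) = q * t by rewrite mulA qx.
  have := ybe_snd_projections hp hx hq.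
  by rewrite !(pxK, qxK, px, qx) projectionK // projection_mulIK //
    projection_mulI.
(* The element [pqp] is fixed by [star], so [pq] is too. *)
have := congr1 star pqp.
by rewrite !starM (proj1 hp) (proj1 hq) -mulA pqp.
Qed.

Lemma ybe_mem_sq a : a = a * (star a * (star a * (a * a))).
Proof.
have ha := projection_mul_star a; have hr := projection_star_mul a.
set q := a * star a in ha; set p := star a * a in hr.
have qa : q * a = a by rewrite /q -mulA mul_star_mul.
have sa : star a * q = star a by rewrite /q star_mul_star.
have lq : lam a q = a by rewrite /lam qa mul_star_mul.
have rq : rho a q = p * q by rewrite /rho (proj1 ha) (mulA _ q) sa mulA.
have pa : p * a = star a * (a * a) by rewrite /p -mulA.
clearbody p q.
have [+ _ _] := ybe_eqs a q q.
rewrite (lam_projection _ ha) !(proj2 ha) lq rq.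
(* The left side of the component is now [lam a (lam (p * q) q)], and its right side is [a]. *)
have -> : lam (p * q) q = p * q.
  rewrite /lam starM (proj1 ha) (proj1 hr) -!mulA (projectionK _ ha).
  by rewrite !projection_mulIK // projection_mulI // projectionK.
by rewrite {1}/lam -mulA qa pa.
Qed.

End YangBaxterSolution.

Lemma star_add_ybe :
  yang_baxter_solution (associated_map star (star_add star)) ->
  [/\ completely_regular S, orthodox S & locally_inverse S].
Proof.
move=> ybe; split.
- exact: projections_completely_regular (ybe_mem_sq ybe).
- exact: projections_orthodox (ybe_mul3_idem ybe).
- exact: projections_locally_inverse (ybe_local_comm ybe).
Qed.

(** By commutativity [d] is an idempotent endomorphism with [x * d x = x], and the map sends
    [(a, b)] to [(a * b, d a * d b)]. Both sides of the first component are [xyz]; in the other two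
    they are [d x * d y * d z]. *)
Lemma star_add_ybe_commutative : commutative (@mul S) ->
  yang_baxter_solution (associated_map star (star_add star)).
Proof.
move=> mulC; pose d x := star x * x.
have mulCA a b c : a * (b * c) = b * (a * c) by rewrite mulA (mulC a) -mulA.
have dM x y : d (x * y) = d x * d y.
  by rewrite /d starM -!mulA mulCA; congr (_ * _); rewrite mulCA.
have [hd dI] : (forall x, projection (d x)) /\ forall x, d x * d x = d x.
  by split=> x; have := projection_star_mul x => // -[].
have dd x : d (d x) = d x by rewrite [LHS]/d (proj1 (hd x)) dI.
have dK x t : d x * (d x * t) = d x * t by rewrite mulA dI.
have mulKd x t : x * (d x * t) = x * t by rewrite /d -mulA mul_star_mulK.
apply/(yang_baxter_components (l := mul) (m := fun a b => d a * d b)).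
  move=> a b; rewrite star_add_mapE /lam /rho; congr (_, _).
    by rewrite (mulC b) mul_star_mulK.
  by rewrite /d -!mulA; congr (_ * _); rewrite mulCA.
move=> x y z; clearbody d; rewrite !dM !dd -!mulA; split.
- by rewrite (mulCA y) mulKd mulKd.
- by rewrite (mulCA (d y) (d x)) dK dK (mulCA (d z)) !dK dI.
- by rewrite (mulCA (d z)) dK dI.
Qed.

Lemma star_oplus_ybe :
  yang_baxter_solution (associated_map star (star_oplus star)) <->
  yang_baxter_solution (associated_map star (star_add star)).
Proof.
have oplusE a b : associated_map star (star_oplus star) (a, b)
    = (star (rho (star b) (star a)), star (lam (star b) (star a))).
  by rewrite /associated_map /star_oplus /lam /rho !starM !starK -!mulA.
apply: iff_trans (yang_baxter_components oplusE) _.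
apply: iff_trans _ (iff_sym (yang_baxter_components star_add_mapE)).
(* Conjugation reverses the triple, so the first and third components trade places and the middle
   one has its sides swapped. *)
split=> eqs x y z.
  have [] := eqs (star z) (star y) (star x); rewrite !starK.
  by move=> /(can_inj starK) e1 /(can_inj starK) e2 /(can_inj starK) e3.
have [] := eqs (star z) (star y) (star x); rewrite !starK => e1 e2 e3.
by split; congr star.
Qed.

End RegularStarSemigroup.

Theorem proposition4p8 (S : magmaType) (star : S -> S)
    (hS : regular_star_semigroup star) :
  ((yang_baxter_solution (associated_map star (star_add star)) ->
      [/\ completely_regular S, orthodox S & locally_inverse S])
   /\ (commutative (@mul S) ->
         yang_baxter_solution (associated_map star (star_add star))))
  /\
  ((yang_baxter_solution (associated_map star (star_oplus star)) ->
      [/\ completely_regular S, orthodox S & locally_inverse S])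
   /\ (commutative (@mul S) ->
         yang_baxter_solution (associated_map star (star_oplus star)))).
Proof.
split; split.
- exact: star_add_ybe.
- exact: star_add_ybe_commutative.
- by move=> /(star_oplus_ybe hS); exact: star_add_ybe.
- by move=> mulC; apply/(star_oplus_ybe hS); exact: star_add_ybe_commutative.
Qed.
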